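(* Let $L$ be a triangulation of the $k$-dimensional simplex such that the only vertices of $L$ on the boundary of the simplex are the original vertices of the simplex. For every $n\geq 0$, the generalized Tchebyshev polynomial of the first kind $T^L_n(x)$ is the $F$-polynomial of the generalized Tchebyshev triangulation, induced by $L$, of the boundary complex of an $n$-dimensional cross-polytope.
   Context: Simplicial complexes are finite abstract simplicial complexes, containing the empty face; $k\geq 1$. The link of a face $\sigma$ of $K$ is $\mathrm{link}_K(\sigma)=\{\tau\in K: \sigma\cap\tau=\emptyset,\ \sigma\cup\tau\in K\}$. $f_i(K)$ is the number of $i$-dimensional faces of $K$. The $F$-polynomial of $K$ is $F(K,x)=\sum_{j=0}^{\dim K+1} f_{j-1}(K)\left(\frac{x-1}{2}\right)^j$. The boundary complex of the $0$-dimensional cross-polytope is $\{\emptyset\}$. $\partial(L)$ denotes the subcomplex of boundary faces of $L$, which is the boundary complex of the original $k$-simplex; $V(\cdot)$ denotes vertex set. A simplicial complex $K'$ is a generalized Tchebyshev triangulation of $K$ induced by $L$ if there is an ordered list $\sigma_1,\ldots,\sigma_m$ of the $k$-dimensional faces of $K$, listing each exactly once, bijections $\phi_{\sigma_i}:V(\partial(L))\to\sigma_i$, and simplicial complexes $K_0=K,K_1,\ldots,K_m=K'$ such that for each $i\geq 1$ the complex $K_i$ is obtained from $K_{i-1}$ as follows: take an isomorphic copy $L_i$ of $L$ in which each boundary vertex $w\in V(\partial(L))$ is identified with $\phi_{\sigma_i}(w)$ and the interior vertices are new vertices, and replace the family of faces $\{\sigma_i\cup\tau:\tau\in\mathrm{link}_{K_{i-1}}(\sigma_i)\}$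 by the family $\{\sigma'\cup\tau:\sigma'\in L_i,\ \tau\in\mathrm{link}_{K_{i-1}}(\sigma_i)\}$. All generalized Tchebyshev triangulations of a given $K$ induced by $L$ have the same $f$-vector, hence the same $F$-polynomial, and there is a unique linear map $T^L:\mathbb{R}[x]\to\mathbb{R}[x]$ with $T^L(F(K,x))=F(K',x)$ for every simplicial complex $K$ and every generalized Tchebyshev triangulation $K'$ of $K$ induced by $L$. One defines $T^L_n(x):=T^L(x^n)$. *)

(* Defs.v *)
From HB Require Import structures.
From mathcomp Require Import all_boot all_order all_algebra finmap.
From mathcomp Require Import all_classical all_reals topology normedtype.

Set Implicit Arguments.
Unset Strict Implicit.
Unset Printing Implicit Defensive.

Import Order.TTheory GRing.Theory Num.Theory.
Import numFieldNormedType.Exports.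

Local Open Scope fset_scope.
Local Open Scope ring_scope.

Section Complexes.
Variable V : choiceType.
Implicit Types (K : {fset {fset V}}) (s t : {fset V}).

Definition is_complex K : Prop :=
  fset0 \in K /\ forall s t, t \in K -> s `<=` t -> s \in K.

Definition vertices K : {fset V} := \bigcup_(s <- K) s.

Definition link K s : {fset {fset V}} :=
  [fset t in K | (s `&` t == fset0) && (s `|` t \in K)].

Definition faces_of_card K (j : nat) : {fset {fset V}} :=
  [fset s in K | #|` s| == j].

(* dim K + 1 *)
Definition rank_of K : nat := (\max_(s <- K) #|` s|)%N.

Definition Fpoly (R : realType) K : {poly R} :=
  \sum_(0 <= j < (rank_of K).+1)
    (#|` faces_of_card K j|)%:R *: ((2%:R^-1 : R) *: ('X - 1)) ^+ j.

(* The abstract cross-polytope whose vertices +-e_i are labelled by v (i, _):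
   the faces of its boundary are the vertex sets without antipodal pairs. *)
Definition cross_polytope_boundary (n : nat) (v : 'I_n * bool -> V) :
    {fset {fset V}} :=
  [fset s in fpowerset [fset v p | p : 'I_n * bool] |
    [forall i : 'I_n, ~~ ((v (i, true) \in s) && (v (i, false) \in s))]].

End Complexes.

Section Triangulations.
Local Open Scope classical_set_scope.

Definition homeomorphism_between (S T : topologicalType)
    (A : set S) (B : set T) (f : S -> T) : Prop :=
  {within A, continuous f} /\ (f @` A `<=` B) /\
  exists g : T -> S,
    [/\ {within B, continuous g}, g @` B `<=` A,
        {in A, cancel f g} & {in B, cancel g f}].

Variables (R : realType).

(* In barycentric coordinates. *)
Definition realization (N : nat) (L : {fset {fset 'I_N}}) : set 'rV[R]_N :=
  [set x | [/\ forall i, 0 <= x ord0 i, \sum_i x ord0 i = 1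
             & [fset i : 'I_N | x ord0 i != 0]%fset \in L]].

Definition std_simplex (k : nat) : set 'rV[R]_k.+1 :=
  [set x | (forall i, 0 <= x ord0 i) /\ \sum_i x ord0 i = 1].

Definition std_simplex_boundary (k : nat) : set 'rV[R]_k.+1 :=
  [set x | std_simplex x /\ exists i, x ord0 i = 0].

Definition point_of (N : nat) (i : 'I_N) : 'rV[R]_N := delta_mx ord0 i.

(* L is a triangulation of the k-simplex, with vertex set 'I_N, whose set of
   boundary vertices is W and consists of the original vertices only. *)
Definition simplex_triangulation (k N : nat)
    (L : {fset {fset 'I_N}}) (W : {fset 'I_N}) : Prop :=
  [/\ is_complex L,
      vertices L = [fset i : 'I_N | true]%fset &
      exists h : 'rV[R]_N -> 'rV[R]_k.+1,
        [/\ homeomorphism_between (realization L) (@std_simplex k) h,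
            forall j : 'I_k.+1, exists i : 'I_N, h (point_of i) = point_of j,
            forall i : 'I_N,
              i \in W <-> std_simplex_boundary (h (point_of i)) &
            forall i : 'I_N, std_simplex_boundary (h (point_of i)) ->
              exists j : 'I_k.+1, h (point_of i) = point_of j]].

End Triangulations.

Section Tchebyshev.
Variables (N : nat) (L : {fset {fset 'I_N}}) (W : {fset 'I_N}).

(* psi restricts to the bijection phi : W -> s and sends the interior vertices
   of L to distinct new vertices, so that it maps L to its copy. *)
Definition subdivision_step (V : choiceType) (s : {fset V})
    (K K' : {fset {fset V}}) : Prop :=
  is_complex K' /\
  exists psi : 'I_N -> V,
    [/\ injective psi, psi @` W = s,
        forall i, i \notin W -> psi i \notin vertices K &
        K' = (K `\` [fset s `|` t | t in link K s])
             `|` [fset s' `|` t | s' in [fset psi @` l | l : {fset 'I_N} in L],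
                                  t in link K s]].

Fixpoint successive_subdivision (V : choiceType) (ss : seq {fset V})
    (K K' : {fset {fset V}}) : Prop :=
  if ss is s :: ss' then
    exists K1, subdivision_step s K K1 /\ successive_subdivision ss' K1 K'
  else K' = K.

Definition tchebyshev_triangulation (k : nat) (V : choiceType)
    (K K' : {fset {fset V}}) : Prop :=
  is_complex K /\
  exists ss : seq {fset V},
    [/\ uniq ss, ss =i faces_of_card K k.+1 & successive_subdivision ss K K'].

(* The property that determines the linear map T^L. *)
Definition is_tchebyshev_map (k : nat) (R : realType)
    (T : {linear {poly R} -> {poly R}}) : Prop :=
  forall (V : choiceType) (K K' : {fset {fset V}}),
    tchebyshev_triangulation k K K' -> T (Fpoly R K) = Fpoly R K'.

End Tchebyshev.

Definition tchebyshev_poly (R : realType) (T : {linear {poly R} -> {poly R}})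
    (n : nat) : {poly R} := T 'X^n.

(* Main.v *)
Require Import Defs.
From mathcomp Require Import all_boot all_order all_algebra finmap.
From mathcomp Require Import all_classical all_reals topology normedtype.

(** The defining property of [T] sends the [F]-polynomial of a complex to that
    of its generalized Tchebyshev triangulations, so the theorem reduces to
    computing that the boundary of the cross-polytope has [F]-polynomial ['X^n]
    ([Fpoly_cross_polytope_boundary]).

    Put [y = (X - 1) / 2].  The [F]-polynomial of any complex is the sum of
    [y ^+ #|s|] over its faces [s] ([Fpoly_sum_faces]).  A face of the boundary
    of the cross-polytope amounts to an independent choice, for each coordinate
    axis, of its positive vertex, its negative vertex, or neither
    ([cross_polytope_boundaryE]).  Such a choice contributes [y], [y] or [1]
    respectively, so the sum over faces factors as
    [(1 + y + y) ^+ n = 'X^n]. *)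

Set Implicit Arguments.
Unset Strict Implicit.
Unset Printing Implicit Defensive.

Import GRing.Theory Num.Theory.

Local Open Scope fset_scope.
Local Open Scope ring_scope.

(** Grouping faces by dimension gets in the way of the product structure of the
    cross-polytope; this form removes the grouping, and with it the dimension
    of the complex. *)
Lemma Fpoly_sum_faces (R : realType) (V : choiceType) (K : {fset {fset V}}) :
  Fpoly R K = \sum_(s <- K) ((2%:R^-1 : R) *: ('X - 1)) ^+ #|` s|.
Proof.
rewrite /Fpoly; set y := _ *: _.
transitivity (\sum_(0 <= j < (rank_of K).+1)
                \sum_(s <- K | #|` s| == j) y ^+ #|` s|).
  apply: eq_bigr => j _.
  rewrite (eq_bigr (fun=> y ^+ j)) => [|s /eqP -> //].
  rewrite big_const_seq iter_addr_0 scaler_nat.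
  by rewrite /faces_of_card card_imfset //= size_filter.
rewrite (exchange_big_dep xpredT) //= big_seq [RHS]big_seq.
apply: eq_bigr => s sK; under eq_bigl do rewrite eq_sym.
rewrite big_nat1_eq /= ltnS.
by rewrite (leq_bigmax_seq (F := fun t : {fset V} => #|` t|)).
Qed.

Section CrossPolytope.
Variables (V : choiceType) (n : nat) (v : 'I_n * bool -> V).
Hypothesis v_inj : injective v.

(** Encoding a face by a function to [option bool] builds in the absence of
    antipodal pairs, and makes the sum over faces a sum over all functions. *)
Definition signed_face (f : {ffun 'I_n -> option bool}) : {fset V} :=
  [fset v p | p : 'I_n * bool & f p.1 == Some p.2].

Lemma mem_signed_face f i b : (v (i, b) \in signed_face f) = (f i == Some b).
Proof. by rewrite mem_imfset. Qed.

Lemma signed_face_inj : injective signed_face.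
Proof.
move=> f g fg; apply/ffunP => i.
have E b : (f i == Some b) = (g i == Some b) by rewrite -!mem_signed_face fg.
by move: (E true) (E false); case: (f i) (g i) => [[]|] [[]|].
Qed.

Lemma card_signed_face f : #|` signed_face f| = (\sum_i (f i != None))%N.
Proof.
rewrite card_imfset //= size_filter -sum1_count big_enum_cond big_mkcond /=.
rewrite -(pair_big xpredT xpredT
            (fun i b => if f i == Some b then 1 else 0)%N) /=.
by apply: eq_bigr => i _; rewrite big_bool; case: (f i) => [[]|].
Qed.

Lemma cross_polytope_boundaryE :
  cross_polytope_boundary v =
  [fset signed_face f | f : {ffun 'I_n -> option bool}].
Proof.
apply/fsetP => s; apply/idP/imfsetP => /=.
  rewrite !inE /= fpowersetE => /andP[/fsubsetP sv /forallP sK].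
  pose f := [ffun i => if v (i, true) \in s then Some true else
                       if v (i, false) \in s then Some false else None].
  exists f => //; apply/fsetP => x; apply/idP/idP => [xs|].
    have /imfsetP[[i b] /= _ xE] := sv _ xs; move: xs; rewrite {}xE.
    (* The preference of [f] for the positive vertex is harmless, since [s]
       does not contain both vertices of an axis. *)
    rewrite mem_signed_face ffunE; move: (sK i).
    by case: b; do 2 case: (_ \in s).
  case/imfsetP => -[i b] /=; rewrite inE ffunE => fib ->; move: fib.
  by case: b; case: ifP => // _; case: ifP.
case=> f _ ->; rewrite !inE fpowersetE; apply/andP; split.
  by apply/fsubsetP => x /imfsetP[p _ ->]; rewrite in_imfset.
by apply/forallP => i; rewrite !mem_signed_face; case: (f i) => [[]|].
Qed.

(** Distributivity turns the sum over all sign functions into a product over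
    the axes, each of which contributes [1 + y + y = 'X]. *)
Lemma Fpoly_cross_polytope_boundary (R : realType) :
  Fpoly R (cross_polytope_boundary v) = 'X^n.
Proof.
rewrite Fpoly_sum_faces cross_polytope_boundaryE; set y := _ *: _.
rewrite big_imfset /=; last by move=> f g _ _; apply: signed_face_inj.
pose F (_ : 'I_n) (o : option bool) := y ^+ (o != None).
transitivity (\sum_(f : {ffun 'I_n -> option bool}) \prod_i F i (f i)).
  rewrite big_enum; apply: eq_bigr => f _.
  by rewrite card_signed_face -prodrXr.
rewrite -bigA_distr_bigA /= -[n in RHS]card_ord -prodr_const.
apply: eq_bigr => i _; rewrite (bigD1 None) // (bigD1 (Some true)) //.
rewrite (bigD1 (Some false)) //= big1 ?addr0; last by case=> [[]|].
rewrite /F /= expr0 expr1.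
rewrite -scalerDl -mulr2n -[_ *+ 2]mulr_natr mulVf ?pnatr_eq0 //.
by rewrite scale1r addrC subrK.
Qed.

End CrossPolytope.

Theorem corollary5p3 (R : realType) (k : nat) (hk : (1 <= k)%N)
    (N : nat) (L : {fset {fset 'I_N}}) (W : {fset 'I_N})
    (hL : simplex_triangulation R k L W)
    (T : {linear {poly R} -> {poly R}}) (hT : is_tchebyshev_map L W k T)
    (n : nat) (V : choiceType) (v : 'I_n * bool -> V) (hv : injective v)
    (K' : {fset {fset V}})
    (hK' : tchebyshev_triangulation L W k (cross_polytope_boundary v) K') :
  tchebyshev_poly T n = Fpoly R K'.
Proof.
by rewrite /tchebyshev_poly -(Fpoly_cross_polytope_boundary hv) (hT _ _ _ hK').
Qed.
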